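(* The coarse version of Dydak's countable asymptotic dimension is preserved by coarse direct products: if $(X,\mathcal{E})$ and $(Y,\mathcal{F})$ are coarse spaces that both have coarse countable asymptotic dimension, then the product coarse space $(X\times Y,\mathcal{E}\ast\mathcal{F})$ has coarse countable asymptotic dimension.
   Context: Coarse spaces. For a set $X$ and $E,F\subseteq X\times X$, the inverse is $E^{-1}=\{(y,x): (x,y)\in E\}$ and the composition is $E\circ F=\{(x,z): \exists y\in X,\ (x,y)\in E \text{ and } (y,z)\in F\}$. A coarse structure on $X$ is a collection $\mathcal{E}$ of subsets of $X\times X$ that contains the diagonal $\{(x,x):x\in X\}$ and is closed under taking subsets, finite unions, inverses, and compositions. Elements of $\mathcal{E}$ are called entourages, and $(X,\mathcal{E})$ is called a coarse space. Product coarse structure. Let $(X_1,\mathcal{E}_1)$ and $(X_2,\mathcal{E}_2)$ be coarse spaces and let $p_i:X_1\times X_2\to X_i$ be the projections, $i\in\{1,2\}$. The product coarse structure on $X_1\times X_2$ is $$\mathcal{E}_1\ast\mathcal{E}_2=\{E\subseteq (X_1\times X_2)^2 : (p_i\times p_i)(E)\in\mathcal{E}_i \text{ for each } i\in\{1,2\}\}.$$ A family $\mathcal{U}$ of subsets of a coarse space $(X,\mathcal{E})$ is uniformly bounded if $\bigcup_{U\in\mathcal{U}}U\times U\in\mathcal{E}$. Decompositions. Let $Z\subseteq X$, let $\mathcal{U}$ be a family of subsets of $X$, let $n$ be a positive integer and let $E\in\mathcal{E}$. One says that $Z$ admits an $(E,n)$-decomposition over $\mathcal{U}$ if $Z$ can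 be expressed as a union of $n$ sets $Z^1,\ldots,Z^n$ such that each $Z^i$ is an $E$-disjoint union of sets from $\mathcal{U}$, meaning that $Z^i=\bigsqcup_j Z^i_j$ (disjoint union), where $Z^i_j\in\mathcal{U}$ for all $j$ and $(Z^i_j\times Z^i_{j'})\cap E=\emptyset$ whenever $j\ne j'$. Coarse countable asymptotic dimension. A coarse space $(X,\mathcal{E})$ has coarse countable asymptotic dimension (the coarse version of Dydak's countable asymptotic dimension) if there is a sequence $(n_i)_{i\ge1}$ of positive integers such that for every sequence $K_1,K_2,\ldots$ of entourages there is a finite sequence $\mathcal{V}_1,\ldots,\mathcal{V}_r$ of families of subsets of $X$ such that $\mathcal{V}_1=\{X\}$, every $V\in\mathcal{V}_i$ admits a $(K_i,n_i)$-decomposition over $\mathcal{V}_{i+1}$ (for each $1\le i<r$), and $\mathcal{V}_r$ is uniformly bounded. *)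

(* Defs.v *)
From mathcomp Require Import all_boot classical_sets.

Set Implicit Arguments.
Unset Strict Implicit.
Unset Printing Implicit Defensive.

Local Open Scope classical_set_scope.
Local Open Scope relation_scope.

Record coarseStructure (X : Type) := CoarseStructure {
  entourages : set (set (X * X));
  entourage_diag : entourages diagonal;
  entourage_sub : forall E F, F `<=` E -> entourages E -> entourages F;
  entourageU : forall E F, entourages E -> entourages F -> entourages (E `|` F);
  entourage_inv : forall E, entourages E -> entourages E^-1;
  (* [F \; E] is the set of (x, z) such that (x, y) in E and (y, z) in F for
     some y *)
  entourage_comp :
    forall E F, entourages E -> entourages F -> entourages (F \; E)
}.

Section Product.
Context {X Y : Type} (EX : coarseStructure X) (EY : coarseStructure Y).

Definition pair_fst (q : (X * Y) * (X * Y)) : X * X := (q.1.1, q.2.1).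
Definition pair_snd (q : (X * Y) * (X * Y)) : Y * Y := (q.1.2, q.2.2).

Definition prod_entourage : set (set ((X * Y) * (X * Y))) :=
  [set E | entourages EX (pair_fst @` E) /\ entourages EY (pair_snd @` E)].

Lemma prod_entourage_diag : prod_entourage diagonal.
Proof.
split; [apply: (entourage_sub _ (entourage_diag EX))
       |apply: (entourage_sub _ (entourage_diag EY))].
- by move=> _ [[p q] /diagonalP -> <-].
- by move=> _ [[p q] /diagonalP -> <-].
Qed.

Lemma prod_entourage_sub E F :
  F `<=` E -> prod_entourage E -> prod_entourage F.
Proof.
move=> FE [E1 E2]; split.
- exact: (entourage_sub (image_subset FE) E1).
- exact: (entourage_sub (image_subset FE) E2).
Qed.

Lemma prod_entourageU E F :
  prod_entourage E -> prod_entourage F -> prod_entourage (E `|` F).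
Proof.
by move=> [E1 E2] [F1 F2]; split; rewrite image_setU; apply: entourageU.
Qed.

Lemma prod_entourage_inv E : prod_entourage E -> prod_entourage E^-1.
Proof.
move=> [/entourage_inv E1 /entourage_inv E2]; split.
- by apply: entourage_sub E1 => _ [[p q] /= pq <-]; exists (q, p).
- by apply: entourage_sub E2 => _ [[p q] /= pq <-]; exists (q, p).
Qed.

Lemma prod_entourage_comp E F :
  prod_entourage E -> prod_entourage F -> prod_entourage (F \; E).
Proof.
move=> [E1 E2] [F1 F2]; split.
- apply: entourage_sub (entourage_comp E1 F1) => _ [[p q] [z /= pz zq] <-].
  by exists z.1; [exists (p, z)|exists (z, q)].
- apply: entourage_sub (entourage_comp E2 F2) => _ [[p q] [z /= pz zq] <-].
  by exists z.2; [exists (p, z)|exists (z, q)].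
Qed.

Definition prod_coarse : coarseStructure (X * Y) :=
  CoarseStructure prod_entourage_diag prod_entourage_sub prod_entourageU
    prod_entourage_inv prod_entourage_comp.

End Product.

Section CountableAsymptoticDimension.
Context {X : Type}.

Definition uniformly_bounded (EX : coarseStructure X) (U : set (set X)) :=
  entourages EX (\bigcup_(A in U) (A `*` A)).

Definition disjoint_union_over (E : set (X * X)) (U : set (set X))
    (Z : set X) :=
  exists (J : Type) (W : J -> set X),
    [/\ Z = \bigcup_j W j,
        forall j, U (W j),
        trivIset setT W
      & forall j k, j <> k -> (W j `*` W k) `&` E = set0].

Definition has_decomposition (E : set (X * X)) (n : nat) (U : set (set X))
    (Z : set X) :=
  exists Zs : 'I_n -> set X,
    Z = \bigcup_i Zs i /\ forall i, disjoint_union_over E U (Zs i).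

(* All sequences are indexed from 0; the finite sequence of families is
   V 0, ..., V r, and the values of V beyond r are irrelevant. *)
Definition coarse_countable_asdim (EX : coarseStructure X) :=
  exists n : nat -> nat, (forall i, 0 < n i) /\
    forall K : nat -> set (X * X), (forall i, entourages EX (K i)) ->
      exists (r : nat) (V : nat -> set (set X)),
        [/\ V 0 = [set [set: X]],
            forall i, i < r ->
              forall A, V i A -> has_decomposition (K i) (n i) (V i.+1) A
          & uniformly_bounded EX (V r)].

End CountableAsymptoticDimension.

(* Main.v *)
Require Import Defs.
From mathcomp Require Import all_boot boolp classical_sets.

Set Implicit Arguments.
Unset Strict Implicit.
Unset Printing Implicit Defensive.

Local Open Scope classical_set_scope.

(** Countable asymptotic dimension passes to products level by level, because
    a decomposition of [A] and a decomposition of [B] multiply to one of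
    [A `*` B].  If [A] is covered by [n] sets that are disjoint unions of
    [E]-separated pieces, and [B] by [m] sets that are disjoint unions of
    [F]-separated pieces, then the [n * m] products of these sets cover
    [A `*` B], and each of them is the disjoint union of the products of the
    pieces.  Two distinct product pieces differ in at least one factor, and
    the separation in that factor already keeps them apart for every relation
    whose projections lie in [E] and [F] ([has_decomposition_prod]).

    So if the sequences [n] and [m] witness the property for the two factors,
    their pointwise product witnesses it for the product space: a sequence [K]
    of product entourages is answered by the families of products [A `*` B],
    with [A] and [B] taken from the answers of the factors to the projections
    of [K].  These two answers may have different lengths, but the shorter one
    can be prolonged by repeating its last family, since a member of a family
    decomposes over that family with itself as the only piece
    ([has_decomposition_stationary]). *)

Definition prod_family {X Y : Type} (U : set (set X)) (V : set (set Y)) :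
    set (set (X * Y)) :=
  [set C | exists A B, [/\ U A, V B & C = A `*` B]].

Lemma disjoint_union_over_prod {X Y : Type} (E : set (X * X))
    (F : set (Y * Y)) (G : set ((X * Y) * (X * Y)))
    (U : set (set X)) (V : set (set Y)) (A : set X) (B : set Y) :
  pair_fst @` G `<=` E -> pair_snd @` G `<=` F ->
  disjoint_union_over E U A -> disjoint_union_over F V B ->
  disjoint_union_over G (prod_family U V) (A `*` B).
Proof.
move=> GE GF [I [S [-> US tS sepS]]] [J [T [-> VT tT sepT]]].
exists (I * J)%type, (fun p => S p.1 `*` T p.2); split.
- apply/seteqP; split=> [[x y] [[i _ Sx] [j _ Ty]]|[x y] [[i j] _ [Sx Ty]]].
    by exists (i, j).
  by split; [exists i|exists j].
- by move=> [i j]; exists (S i), (T j).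
- move=> [i j] [i' j'] _ _ [[x y] [[Sx Ty] [Sx' Ty']]].
  have -> : i = i' by apply: tS => //; exists x.
  by have -> : j = j' by apply: tT => //; exists y.
- move=> [i j] [i' j'] neq; apply/seteqP; split=> // -[[x y] [x' y']].
  move=> [[[Sx Ty] [Sx' Ty']] Gxy]; have [eqi|neqi] := pselect (i = i').
    have neqj : j <> j' by move=> eqj; apply: neq; rewrite eqi eqj.
    suff : set0 (y, y') by [].
    rewrite -(sepT _ _ neqj); split=> //.
    by apply: GF; exists ((x, y), (x', y')).
  suff : set0 (x, x') by [].
  rewrite -(sepS _ _ neqi); split=> //.
  by apply: GE; exists ((x, y), (x', y')).
Qed.

Lemma has_decomposition_fin {X : Type} {I : finType} (E : set (X * X))
    (U : set (set X)) (Zs : I -> set X) :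
  (forall i, disjoint_union_over E U (Zs i)) ->
  has_decomposition E #|I| U (\bigcup_i Zs i).
Proof.
move=> dZ; exists (fun k => Zs (enum_val k)); split=> [|k]; last exact: dZ.
apply/seteqP; split=> x [k _ Zx]; last by exists (enum_val k).
by exists (enum_rank k); rewrite ?enum_rankK.
Qed.

(** The sets of the two decompositions are paired in all possible ways, and by
    [disjoint_union_over_prod] each product of two of them is one admissible
    set, which is why the numbers of sets multiply. *)
Lemma has_decomposition_prod {X Y : Type} (E : set (X * X))
    (F : set (Y * Y)) (G : set ((X * Y) * (X * Y))) (n m : nat)
    (U : set (set X)) (V : set (set Y)) (A : set X) (B : set Y) :
  pair_fst @` G `<=` E -> pair_snd @` G `<=` F ->
  has_decomposition E n U A -> has_decomposition F m V B ->
  has_decomposition G (n * m) (prod_family U V) (A `*` B).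
Proof.
move=> GE GF [S [-> dS]] [T [-> dT]].
have -> : (\bigcup_i S i) `*` (\bigcup_j T j) =
    \bigcup_(p : 'I_n * 'I_m) (S p.1 `*` T p.2).
  apply/seteqP; split=> [[x y] [[i _ Sx] [j _ Ty]]|[x y] [[i j] _ [Sx Ty]]].
    by exists (i, j).
  by split; [exists i|exists j].
have -> : n * m = #|{: 'I_n * 'I_m}| by rewrite card_prod !card_ord.
apply: has_decomposition_fin => p.
exact: (disjoint_union_over_prod GE GF (dS p.1) (dT p.2)).
Qed.

(** The [n] sets of a decomposition may overlap, so all of them can be the
    whole set; only [n = 0] has to be excluded. *)
Lemma has_decomposition_self {X : Type} (E : set (X * X)) (n : nat)
    (U : set (set X)) (A : set X) :
  0 < n -> U A -> has_decomposition E n U A.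
Proof.
case: n => // n _ UA; exists (fun=> A); split=> [|_].
  by apply/seteqP; split=> [x Ax|x [] //]; exists ord0.
exists unit, (fun=> A); split=> // [|[] [] //|[] [] //].
by apply/seteqP; split=> [x Ax|x [] //]; exists tt.
Qed.

(** Freezing a finite sequence of families at its last term keeps the
    decomposition property at every level, which lets two sequences of
    different lengths run in parallel. *)
Lemma has_decomposition_stationary {X : Type} (K : nat -> set (X * X))
    (n : nat -> nat) (r : nat) (V : nat -> set (set X)) :
  (forall i, 0 < n i) ->
  (forall i, i < r ->
    forall A, V i A -> has_decomposition (K i) (n i) (V i.+1) A) ->
  forall i A, V (minn i r) A ->
    has_decomposition (K i) (n i) (V (minn i.+1 r)) A.
Proof.
move=> n_gt0 dV i A; have [ir|ri] := ltnP i r.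
  by rewrite (minn_idPl ir); apply: dV.
rewrite (minn_idPr (leqW ri)).
exact: has_decomposition_self.
Qed.

Lemma uniformly_bounded_prod {X Y : Type} (EX : coarseStructure X)
    (EY : coarseStructure Y) (U : set (set X)) (V : set (set Y)) :
  uniformly_bounded EX U -> uniformly_bounded EY V ->
  uniformly_bounded (prod_coarse EX EY) (prod_family U V).
Proof.
move=> bU bV; split.
  apply: entourage_sub bU => _ [[p q] [_ [A [B [UA VB ->]]] [[Ap _] [Aq _]]] <-].
  by exists A.
apply: entourage_sub bV => _ [[p q] [_ [A [B [UA VB ->]]] [[_ Bp] [_ Bq]]] <-].
by exists B.
Qed.

Lemma prod_family_setT {X Y : Type} :
  prod_family [set [set: X]] [set [set: Y]] = [set [set: X * Y]].
Proof.
apply/seteqP; split=> [_ [_ [_ [-> -> ->]]]|_ ->]; first exact: setXTT.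
by exists setT, setT; rewrite setXTT.
Qed.

Theorem corollary2p3 (X Y : Type) (EX : coarseStructure X)
    (EY : coarseStructure Y) :
  coarse_countable_asdim EX -> coarse_countable_asdim EY ->
  coarse_countable_asdim (prod_coarse EX EY).
Proof.
move=> [n [n_gt0 dimX]] [m [m_gt0 dimY]].
exists (fun i => n i * m i); split=> [i|K entK].
  by rewrite muln_gt0 n_gt0 m_gt0.
have [r [V [V0 dV bV]]] := dimX (fun i => pair_fst @` K i)
  (fun i => proj1 (entK i)).
have [s [W [W0 dW bW]]] := dimY (fun i => pair_snd @` K i)
  (fun i => proj2 (entK i)).
exists (maxn r s), (fun i => prod_family (V (minn i r)) (W (minn i s))).
split.
- by rewrite !min0n V0 W0 prod_family_setT.
- move=> i _ _ [A [B [VA WB ->]]].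
  apply: (has_decomposition_prod (E := pair_fst @` K i)
    (F := pair_snd @` K i)) => //.
    exact: (has_decomposition_stationary n_gt0 dV).
  exact: (has_decomposition_stationary m_gt0 dW).
- rewrite (minn_idPr (leq_maxl r s)) (minn_idPr (leq_maxr r s)).
  exact: uniformly_bounded_prod.
Qed.
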